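(* Let $A=(a_{i,j})$ be an $n\times n$ matrix with entries in a totally ordered commutative group $M$, and let $G$ be the weighted directed graph on the vertices $\{0,1,\dots,n\}$ with weight $w_{i,0}=0$ on the edge $(i,0)$ and $w_{i,j}=a_{i,i}-a_{j,i}$ on the edge $(i,j)$, for $1\le i,j\le n$. (i) The entries $a_{i,i}$ of $A$ form a maximal transversal sum, i.e. $\sum_{i=1}^n a_{i,i}=\max_{\sigma\in S_n}\sum_{i=1}^n a_{i,\sigma(i)}$, if and only if $G$ admits no strictly negative cycle. (ii) Assuming that the $a_{i,i}$ form a maximal transversal sum, a vector $\lambda\in M^n$ is the minimal canon of $A$ if and only if, for all $1\le i\le n$, there is a shortest path of length $-\lambda_i$ from vertex $i$ to vertex $0$ in $G$.
   Context: $S_n$ is the group of permutations of $\{1,\dots,n\}$. A canon of $A$ is a vector $\ell\in M^n$ with all $\ell_i\ge 0$ such that the matrix $A+\ell=(a_{i,j}+\ell_i)$ possesses $n$ entries located in pairwise different rows and columns, each maximal in its column. The minimal canon is the least canon for the componentwise order. The length of a path or cycle is the sum of the weights of its edges; a cycle is strictly negative if its length is $<0$. Reciprocally, to any such weighted graph one associates a matrix $A$ by setting $a_{i,i}=C=\max(0,\max_{i,j}w_{i,j})$ and $a_{j,i}=C-w_{i,j}$. *)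

(* Defs.v *)
From HB Require Import structures.
From mathcomp Require Import all_boot all_order all_fingroup all_algebra.

Set Implicit Arguments.
Unset Strict Implicit.
Unset Printing Implicit Defensive.

Import Order.TTheory GRing.Theory.

Local Open Scope ring_scope.

(* porderZmodType combines an additive group with a partial order but does not
   ask for their compatibility. Totality is an axiom of the mixin and not an
   inherited Order.Total because the join of Order.Total and Num.POrderedZmodule
   would have to be declared before Num.RealDomain. *)
HB.mixin Record POrderedZmodule_isTotallyOrdered M & Num.POrderedZmodule M := {
  orderedz_total : total (<=%O : rel M);
  orderedz_leD2l : forall z x y : M, x <= y -> z + x <= z + y
}.

#[short(type="orderedZmodType")]
HB.structure Definition OrderedZmodule :=
  { M of Num.POrderedZmodule M & POrderedZmodule_isTotallyOrdered M }.

Section Canons.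
Variables (M : orderedZmodType) (n : nat).
Implicit Types (A : 'M[M]_n) (l : 'cV[M]_n) (s : 'S_n).

Definition transversal_sum A s : M := \sum_(i < n) A i (s i).

Definition max_transversal_sum A : M :=
  transversal_sum A [arg max_(s > 1%g) transversal_sum A s]%O.

Definition addcol A l : 'M[M]_n := \matrix_(i, j) (A i j + l i ord0).

Definition is_canon A l : Prop :=
  (forall i, 0 <= l i ord0) /\
  exists s, forall i k, addcol A l k (s i) <= addcol A l i (s i).

Definition is_minimal_canon A l : Prop :=
  is_canon A l /\
  forall l', is_canon A l' -> forall i, l i ord0 <= l' i ord0.

End Canons.

(* The weight is only meaningful on edges. *)
Record wdigraph (M : Type) (V : Type) := WDigraph {
  edge : rel V;
  weight : V -> V -> M
}.

Section Paths.
Variables (M : orderedZmodType) (V : eqType) (G : wdigraph M V).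

(* As in path, x :: p is the list of the successive vertices. *)
Definition path_length (x : V) (p : seq V) : M :=
  \sum_(a <- pairmap (weight G) x p) a.

Definition cycle_length (c : seq V) : M :=
  if c is x :: p then path_length x (rcons p x) else 0.

Definition is_path (x y : V) (p : seq V) : Prop :=
  path (edge G) x p /\ last x p = y.

Definition is_shortest_path (x y : V) (p : seq V) : Prop :=
  is_path x y p /\
  forall q, is_path x y q -> path_length x p <= path_length x q.

(* Vertices may be repeated in paths and cycles. *)
Definition has_negative_cycle : Prop :=
  exists2 c : seq V, path.cycle (edge G) c & cycle_length c < 0.

End Paths.

(* Vertex 0 is ord0; the row index i : 'I_n is the vertex lift ord0 i.
   No edge leaves 0. *)
Definition matrix_graph (M : orderedZmodType) (n : nat) (A : 'M[M]_n) :
    wdigraph M 'I_n.+1 :=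
  WDigraph (fun u _ => u != ord0)
    (fun u v => match unlift ord0 u, unlift ord0 v with
                | Some i, Some j => A i i - A j i
                | _, _ => 0
                end).

(* Main.v *)
Require Import Defs.
From mathcomp Require Import all_boot all_order all_fingroup all_algebra.

Set Implicit Arguments.
Unset Strict Implicit.
Unset Printing Implicit Defensive.

Import Order.TTheory GRing.Theory.

Local Open Scope ring_scope.

(** The bridge between the two sides is the notion of potential. If the diagonal
    of [A] is a maximal transversal, every canon [l] is witnessed by the identity
    permutation: adding [l] changes all transversal sums by the same amount, so
    the diagonal stays maximal and has the same sum as the transversal of column
    maxima, and two equal sums with termwise comparable terms agree termwise.
    Hence the canons are the nonnegative [l] with [A k j + l k <= A j j + l j],
    that is [- l j <= w_{j,k} - l k] ([diag_canon], [is_canon_diag]). This says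
    that [- l], extended by [0] at the sink [0], is a potential on the graph: along
    an edge it drops by at most the weight, the edges to the sink giving
    [- l i <= 0].
    Following a path from [i] to [0], [- l i] is at most its length
    ([diag_canon_path]); conversely the distances to [0] form a potential
    ([shortest_diag_canon]), which is therefore the greatest one. Thus the
    minimal canon is the opposite of the distances to [0], which is (ii).

    Distances exist when no cycle is negative, because removing cycles reduces
    the search to the finitely many simple paths ([simple_path_le],
    [shortest_path_exists]). For (i), if no cycle is negative, the canon built
    from the distances certifies that the diagonal is maximal
    ([diag_canon_max]). If the diagonal is maximal, a simple cycle read as a
    permutation has as its length the difference between the diagonal sum and
    another transversal sum, hence is nonnegative ([diag_max_simple_cycle]); the
    removal of simple cycles extends this to all closed walks
    ([no_negative_cycle]). *)

(** * Totally ordered groups *)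

Section OrderedZmod.
Variable M : orderedZmodType.
Implicit Types x y z t : M.

Lemma oz_leD x y z t : x <= y -> z <= t -> x + z <= y + t.
Proof.
move=> xy zt; apply: (le_trans (orderedz_leD2l x _ _ zt)).
by rewrite ![_ + t]addrC; apply: orderedz_leD2l.
Qed.

Lemma oz_leD2lE z x y : (z + x <= z + y) = (x <= y).
Proof.
apply/idP/idP => [/(orderedz_leD2l (- z))|]; last exact: orderedz_leD2l.
by rewrite !addKr.
Qed.

Lemma oz_leD2rE z x y : (x + z <= y + z) = (x <= y).
Proof. by rewrite ![_ + z]addrC oz_leD2lE. Qed.

Lemma oz_leN x y : (- x <= - y) = (y <= x).
Proof. by rewrite -[LHS](oz_leD2lE (x + y)) addrK addrAC subrr add0r. Qed.

Lemma oz_subr_ge0 x y : (0 <= x - y) = (y <= x).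
Proof. by rewrite -[LHS](oz_leD2rE y) add0r subrK. Qed.

(** The correspondence between canons and potentials: here [a] and [b] are entries
    of one column, with [a] on the diagonal, [y] and [x] are the increments of
    their rows, and [a - b] is the weight of an edge. *)
Lemma oz_le_potential (a b x y : M) : (b + x <= a + y) = (- y <= a - b - x).
Proof.
rewrite -[RHS](oz_leD2rE (y + (b + x))) addKr -[a - b - x]addrA -opprD.
by rewrite [y + _]addrC addrA subrK.
Qed.

Lemma oz_leNgt x y : (x <= y) = ~~ (y < x).
Proof.
apply/idP/idP => [xy|]; first by apply/negP => /(le_lt_trans xy); rewrite ltxx.
by have /orP[//|yx] := orderedz_total x y; rewrite lt_neqAle yx andbT negbK => /eqP->.
Qed.

Lemma oz_le_sum (I : Type) (r : seq I) (P : pred I) (F G : I -> M) :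
  (forall i, P i -> F i <= G i) ->
  \sum_(i <- r | P i) F i <= \sum_(i <- r | P i) G i.
Proof.
by move=> FG; apply: (big_ind2 (fun x y => x <= y)) => // *; apply: oz_leD.
Qed.

Lemma oz_eq_sum (I : finType) (F G : I -> M) :
  (forall i, F i <= G i) -> \sum_i F i = \sum_i G i -> F =1 G.
Proof.
move=> FG eqFG j; apply: le_anti; rewrite FG /=.
move: eqFG; rewrite (bigD1 j) //= [RHS](bigD1 j) //= => eqj.
by rewrite -(oz_leD2rE (\sum_(i | i != j) G i)) -eqj oz_leD2lE oz_le_sum.
Qed.

Lemma oz_arg_minP (I : finType) (P : pred I) (F : I -> M) i0 : P i0 ->
  exists2 i, P i & forall j, P j -> F i <= F j.
Proof.
move=> Pi0; have Ftotal : total (<=%O : rel M) by exact: orderedz_total.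
by have [i Pi iP] := extremumP F (@lexx _ M) (@le_trans _ M) Ftotal Pi0; exists i.
Qed.

End OrderedZmod.

(** * Shortest paths in weighted digraphs *)

Section Digraph.
Variables (M : orderedZmodType) (V : finType) (G : wdigraph M V).

Lemma path_length_cons x y p :
  path_length G x (y :: p) = weight G x y + path_length G y p.
Proof. by rewrite /path_length /= big_cons. Qed.

Lemma path_length_cat x p q :
  path_length G x (p ++ q) = path_length G x p + path_length G (last x p) q.
Proof. by rewrite /path_length pairmap_cat big_cat. Qed.

Lemma cycle_length_next c : uniq c ->
  cycle_length G c = \sum_(x <- c) weight G x (next c x).
Proof.
case: c => [|x p] Uc; first by rewrite big_nil.
(* The return vertex x stays fixed while the current vertex y moves along p. *)
suff walk y : uniq (y :: p) -> path_length G y (rcons p x) =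
    \sum_(z <- y :: p) weight G z (next_at z x y p) by exact: walk.
elim: p y {Uc} => [|z p IHp] y /=.
  by rewrite path_length_cons /path_length /= big_nil addr0 big_seq1 /= eqxx.
case/andP=> yzp Uzp; rewrite path_length_cons big_cons eqxx IHp //; congr (_ + _).
by apply: eq_big_seq => u uzp; case: eqP => // uy; rewrite uy (negPf yzp) in uzp.
Qed.

(** A potential [d] bounds distances from below: the inequalities on the edges of
    a path add up. *)
Lemma potential_path (d : V -> M) x p :
  (forall u v, edge G u v -> d u <= weight G u v + d v) ->
  path (edge G) x p -> d x <= path_length G x p + d (last x p).
Proof.
move=> dE; elim: p x => [|y p IHp] x /=.
  by rewrite /path_length big_nil add0r.
case/andP=> /dE dxy /IHp dy; rewrite path_length_cons -addrA.
by apply: (le_trans dxy); rewrite oz_leD2lE.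
Qed.

Hypothesis simple_cycle_ge0 :
  forall c, uniq c -> path.cycle (edge G) c -> 0 <= cycle_length G c.

(** Prepending a vertex [x] to a simple path either keeps it simple or closes
    exactly one cycle, from [x] back to its occurrence in the path; this cycle
    is itself simple, so that deleting it only needs simple cycles to be
    nonnegative. *)
Lemma simple_path_le x y p : is_path G x y p ->
  exists q, [/\ is_path G x y q, uniq (x :: q) &
                path_length G x q <= path_length G x p].
Proof.
elim: p x => [|z p IHp] x [/=]; first by move=> _ <-; exists [::].
case/andP=> xz zp zy; have [q [[zq qy] Uzq leqp]] := IHp z (conj zp zy).
have [xzq | xzq] := boolP (x \in z :: q); last first.
  exists (z :: q); split; first by split=> //=; rewrite xz.
    by rewrite cons_uniq xzq.
  by rewrite !path_length_cons oz_leD2lE.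
have leq' : path_length G x (z :: q) <= path_length G x (z :: p).
  by rewrite !path_length_cons oz_leD2lE.
have : path (edge G) x (z :: q) by rewrite /= xz.
have : last x (z :: q) = y by [].
move: leq' Uzq; case/path.splitP: xzq => r t leq' Urt.
rewrite last_cat cat_path last_rcons => ty /andP[xr xt].
have Uxt : uniq (x :: t) by move: Urt; rewrite cat_rcons cat_uniq => /and3P[].
have Uxr : uniq (x :: r).
  by move: Urt; rewrite cat_uniq rcons_uniq => /andP[].
have := simple_cycle_ge0 Uxr xr; rewrite /cycle_length => r_ge0.
exists t; split=> //; apply: le_trans leq'.
by rewrite path_length_cat last_rcons -{1}[path_length G x t]add0r oz_leD2rE.
Qed.

(** A closed walk is no shorter than a simple path from its origin to itself,
    and the only such path is empty. *)
Lemma no_negative_cycle : ~ has_negative_cycle G.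
Proof.
case=> -[|x p] /=; first by rewrite ltxx.
move=> xp; have [|[|y q] [[_ /= qx] Uq leqp]] := @simple_path_le x x (rcons p x).
- by split=> //; rewrite last_rcons.
- by apply/negP; rewrite -oz_leNgt; move: leqp; rewrite {1}/path_length big_nil.
- by move: Uq; rewrite /= -{1}qx mem_last.
Qed.

(** Simple paths have bounded size, hence are finitely many, and each path is
    at least as long as a simple one. *)
Lemma shortest_path_exists x y p :
  is_path G x y p -> exists q, is_shortest_path G x y q.
Proof.
case/simple_path_le => p0 [[xp0 p0y] Up0 _].
have small q : uniq (x :: q) -> (size q <= #|V|)%N.
  by move=> Uq; apply: leq_trans (max_card (mem (x :: q))); rewrite (card_uniqP Uq).
pose P (b : {bseq #|V| of V}) := path (edge G) x b && (last x b == y).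
have Pp0 : P (Bseq (small _ Up0)) by rewrite /P /= xp0 p0y eqxx.
have [b /andP[xb /eqP bY] bP] :=
  oz_arg_minP (fun b : {bseq #|V| of V} => path_length G x b) Pp0.
exists b; split=> // q /simple_path_le[r [[xr ry] Ur lerq]].
apply: le_trans lerq; apply: (bP (Bseq (small _ Ur))).
by rewrite /P /= xr ry eqxx.
Qed.

End Digraph.

(** * Canons as potentials *)

Section MatrixGraph.
Variables (M : orderedZmodType) (n : nat) (A : 'M[M]_n).
Implicit Types (l : 'cV[M]_n) (i j k : 'I_n).

Let G := matrix_graph A.
Let vtx i : 'I_n.+1 := lift ord0 i.

Lemma weight_vtx i j : weight G (vtx i) (vtx j) = A i i - A j i.
Proof. by rewrite /= !liftK. Qed.

Lemma weight_sink u : weight G u ord0 = 0.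
Proof. by rewrite /= unlift_none; case: unlift. Qed.

Lemma is_path_vtx i v y p : is_path G v y p -> is_path G (vtx i) y (v :: p).
Proof. by []. Qed.

Definition diag_max := forall s, transversal_sum A s <= \sum_i A i i.

Lemma max_transversal_sumP : \sum_i A i i = max_transversal_sum A <-> diag_max.
Proof.
have getr : transitive (>=%O : rel M) by move=> y x z /[swap]; apply: le_trans.
have getot : total (>=%O : rel M) by move=> x y; apply: orderedz_total.
rewrite /max_transversal_sum /Order.arg_max.
have [//|s _ sP] := extremumP (ord := >=%O) (transversal_sum A) (@lexx _ M) getr getot.
have diag1 : \sum_i A i i = transversal_sum A 1%g.
  by apply: eq_bigr => i _; rewrite perm1.
split=> [eqA t | maxA]; first by rewrite eqA; apply: sP.
by apply: le_anti; rewrite maxA andbT diag1; apply: sP.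
Qed.

(** The canons witnessed by the identity permutation: with the permutation fixed,
    being a canon is a system of inequalities on [l], one for each edge of the
    graph. *)
Definition diag_canon l : Prop :=
  (forall i, 0 <= l i ord0) /\
  forall j k, A k j + l k ord0 <= A j j + l j ord0.

Lemma diag_canon_is_canon l : diag_canon l -> is_canon A l.
Proof.
case=> l0 lP; split=> //; exists 1%g => i k.
by rewrite !mxE perm1.
Qed.

(** In [addcol A l] the diagonal sum is at least that of the witness of the canon
    by maximality, and at most it because the terms of the witness are column
    maxima; so the diagonal entries are column maxima as well. *)
Lemma is_canon_diag l : diag_max -> is_canon A l -> diag_canon l.
Proof.
move=> maxA [l0 [s sP]]; split=> // j k.
have le_s i : A (s i) (s i) + l (s i) ord0 <= A i (s i) + l i ord0.
  by have := sP i (s i); rewrite !mxE.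
have reidx (F : 'I_n -> M) : \sum_i F (s i) = \sum_i F i.
  by rewrite [RHS](reindex_inj (@perm_inj _ s)).
have eq_s : forall i, A (s i) (s i) + l (s i) ord0 = A i (s i) + l i ord0.
  apply: (oz_eq_sum le_s); apply: le_anti; rewrite oz_le_sum //=.
  rewrite (reidx (fun i => A i i + l i ord0)) !big_split /= oz_leD2rE.
  exact: maxA.
by have := sP (s^-1 j)%g k; rewrite !mxE -eq_s permKV.
Qed.

(** Summing the inequalities between the entries [(i, s i)] and [(s i, s i)] of
    [addcol A l], the contributions of [l] cancel. *)
Lemma diag_canon_max l : diag_canon l -> diag_max.
Proof.
case=> _ lP s; rewrite -(oz_leD2rE (\sum_i l i ord0)) -!big_split /=.
rewrite [leRHS](reindex_inj (@perm_inj _ s)) /=.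
by apply: oz_le_sum => i _; apply: lP.
Qed.

Lemma diag_canon_path l i p : diag_canon l ->
  is_path G (vtx i) ord0 p -> - l i ord0 <= path_length G (vtx i) p.
Proof.
case=> l0 lP [ip p0].
pose d (u : 'I_n.+1) : M := if unlift ord0 u is Some j then - l j ord0 else 0.
have dE u v : edge G u v -> d u <= weight G u v + d v.
  rewrite /d /=; case: unliftP => [j ->|->]; last by rewrite eqxx.
  move=> _; case: unliftP => [k _|_]; last by rewrite addr0 -oz_leN oppr0 opprK.
  by rewrite -oz_le_potential.
have := potential_path dE ip.
by rewrite p0 /d /vtx liftK unlift_none addr0.
Qed.

(** The two families of inequalities of a canon compare the shortest path from
    [i] with the edge from [i] to the sink, and the shortest path from [j] with
    the detour through [k]. *)
Lemma shortest_diag_canon l :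
  (forall i, exists p, is_shortest_path G (vtx i) ord0 p /\
                       path_length G (vtx i) p = - l i ord0) ->
  diag_canon l.
Proof.
move=> lP; split=> [i | j k].
  have [p [[_ pmin] plen]] := lP i; rewrite -oz_leN oppr0 -plen.
  have := pmin [:: ord0]; rewrite path_length_cons weight_sink add0r.
  rewrite {2}/path_length big_nil; by apply; apply: is_path_vtx.
have [p [[_ pmin] plen]] := lP j; have [q [[[kq q0] _] qlen]] := lP k.
have: path_length G (vtx j) p <= path_length G (vtx j) (vtx k :: q).
  by apply: pmin; apply: is_path_vtx.
by rewrite path_length_cons weight_vtx plen qlen -oz_le_potential.
Qed.

Lemma distance_vector_exists : ~ has_negative_cycle G ->
  exists l, forall i, exists p, is_shortest_path G (vtx i) ord0 p /\
                                path_length G (vtx i) p = - l i ord0.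
Proof.
move=> noneg.
have cyc_ge0 c : uniq c -> path.cycle (edge G) c -> 0 <= cycle_length G c.
  by move=> _ Gc; rewrite oz_leNgt; apply/negP => c_lt0; apply: noneg; exists c.
have short i : exists p, is_shortest_path G (vtx i) ord0 p.
  apply: (shortest_path_exists cyc_ge0 (p := [:: ord0])).
  exact: is_path_vtx.
have [f fP] := fin_all_exists short.
exists (\col_i - path_length G (vtx i) (f i)) => i.
by exists (f i); rewrite mxE opprK.
Qed.

(** The successor function of a simple cycle, extended by the identity, is a
    permutation whose fixed points contribute [A i i - A i i = 0]; so the length
    of the cycle is the difference between the diagonal sum and the transversal
    sum of the inverse permutation. *)
Lemma diag_max_simple_cycle c : diag_max ->
  uniq c -> path.cycle (edge G) c -> 0 <= cycle_length G c.
Proof.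
move=> maxA Uc Gc.
(* The sink has no outgoing edge, so it lies on no cycle. *)
have [b defc] : exists b, c = map vtx b.
  exists (pmap (unlift ord0) c); rewrite -[LHS](map_id c).
  have : all (fun u => u != ord0) c.
    apply/allP => u uc; exact: (next_cycle Gc uc).
  elim: c {Uc Gc} => //= u c IHc /andP[u0 /IHc->].
  by case: unliftP u0 => [i -> _|->]; rewrite ?eqxx.
have vtx_inj : injective vtx by exact: lift_inj.
have Ub : uniq b by rewrite defc map_inj_uniq in Uc.
pose s := perm (can_inj (prev_next Ub)).
rewrite cycle_length_next // defc big_map.
under eq_bigr => i _ do rewrite next_map // weight_vtx.
rewrite big_uniq //= big_mkcond /=.
rewrite (eq_bigr (fun i => A i i - A (s i) i)) => [|i _]; last first.
  by rewrite permE; case: ifP => // /negbT ib; rewrite next_nth (negPf ib) subrr.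
rewrite sumrB oz_subr_ge0; apply: le_trans (maxA s^-1%g).
rewrite /transversal_sum [leRHS](reindex_inj (@perm_inj _ s)) /=.
by apply: oz_le_sum => i _; rewrite permK.
Qed.

End MatrixGraph.

Theorem proposition70 (M : orderedZmodType) (n : nat) (A : 'M[M]_n) :
  (\sum_(i < n) A i i = max_transversal_sum A
     <-> ~ has_negative_cycle (matrix_graph A)) /\
  (\sum_(i < n) A i i = max_transversal_sum A ->
   forall lambda : 'cV[M]_n,
     is_minimal_canon A lambda <->
     forall i : 'I_n, exists p : seq 'I_n.+1,
       is_shortest_path (matrix_graph A) (lift ord0 i) ord0 p /\
       path_length (matrix_graph A) (lift ord0 i) p = - lambda i ord0).
Proof.
have diag_noneg : diag_max A -> ~ has_negative_cycle (matrix_graph A).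
  by move=> maxA; apply: no_negative_cycle => c; apply: diag_max_simple_cycle.
split.
  split=> [/max_transversal_sumP // | noneg]; apply/max_transversal_sumP.
  have [l /shortest_diag_canon] := distance_vector_exists noneg.
  exact: diag_canon_max.
move=> /max_transversal_sumP maxA.
have dist_minimal (l : 'cV[M]_n) :
    (forall i, exists p, is_shortest_path (matrix_graph A) (lift ord0 i) ord0 p /\
       path_length (matrix_graph A) (lift ord0 i) p = - l i ord0) ->
    is_minimal_canon A l.
  move=> lP; split; first exact/diag_canon_is_canon/shortest_diag_canon.
  move=> l' /(is_canon_diag maxA) l'P i; have [p [[ip _] plen]] := lP i.
  by rewrite -oz_leN -plen; apply: diag_canon_path.
move=> l; split; last exact: dist_minimal.
case=> lcanon lmin; have [l0 l0P] := distance_vector_exists (diag_noneg maxA).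
have [l0canon l0min] := dist_minimal l0 l0P.
suff -> : l = l0 by [].
apply/matrixP => i j; rewrite (ord1 j); apply: le_anti.
by rewrite lmin //= l0min.
Qed.
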